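(* Let $\widetilde{P}(x,u,q)=\sum_{k\geq1}\sum_{n\geq k}\sum_{\pi\in P_{n,k}}\frac{x^nu^kq^{\mathrm{swrec}(\pi)}}{n!}$. Then $$\frac{\partial}{\partial q}\widetilde{P}(x,u,q)\Big|_{u=q=1}=e^{e^x-1}\left(\frac{3}{4}e^{3x}+\frac{3}{2}e^{2x}-\frac{7}{4}e^x-xe^{2x}-\frac{3}{2}xe^x-\frac{1}{2}\right).$$ Equivalently, $\sum_{n\geq0}\Big(\sum_{\pi\in P_n}\mathrm{swrec}(\pi)\Big)\frac{x^n}{n!}$ equals the right-hand side.
   Context: A partition of $[n]=\{1,\dots,n\}$ into exactly $k$ blocks is a collection $\{B_1,\dots,B_k\}$ of nonempty, pairwise disjoint subsets with union $[n]$, with $\min B_1<\cdots<\min B_k$. Its canonical sequential form is the word $\pi=\pi_1\cdots\pi_n$ where $i\in B_{\pi_i}$. $P_{n,k}$ denotes the set of partitions of $[n]$ with exactly $k$ blocks and $P_n=\bigcup_k P_{n,k}$ the set of all partitions of $[n]$, identified with their canonical sequential forms. In a word $\pi=\pi_1\cdots\pi_n$, the entry $\pi_i$ is a record (at position $i$) if $\pi_i>\pi_j$ for all $j<i$. The statistic $\mathrm{swrec}(\pi)$ is the sum over all records $\pi_i$ of $\pi$ of $i\cdot\pi_i$. *)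

(* Defs.v *)
From mathcomp Require Import all_boot all_order all_algebra.

Set Implicit Arguments.
Unset Strict Implicit.
Unset Printing Implicit Defensive.

Import GRing.Theory.

(** * Set partitions, canonical sequential forms and swrec *)

(* The ground set [n] = {1, ..., n} is represented by 'I_n: the ordinal i
   stands for the element (and the position) i + 1. *)

Definition set_partitions (n : nat) : {set {set {set 'I_n}}} :=
  [set P | partition P [set: 'I_n]].

Definition set_partitions_into (n k : nat) : {set {set {set 'I_n}}} :=
  [set P | partition P [set: 'I_n] & #|P| == k].

(* The default value n is only returned on the empty set. *)
Definition block_min (n : nat) (B : {set 'I_n}) : nat :=
  \big[minn/n]_(i in B) (i : nat).

(* The list B_1, ..., B_k with min B_1 < ... < min B_k. *)
Definition ordered_blocks (n : nat) (P : {set {set 'I_n}}) : seq {set 'I_n} :=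
  sort (fun B C => block_min B <= block_min C) (enum P).

(* The word pi_1 ... pi_n with i \in B_(pi_i); block numbers start at 1. *)
Definition canonical_form (n : nat) (P : {set {set 'I_n}}) : seq nat :=
  [seq (index (pblock P i) (ordered_blocks P)).+1 | i <- enum 'I_n].

(* Here i is the 0-based position. *)
Definition is_record (w : seq nat) (i : nat) : bool :=
  [forall j : 'I_i, nth 0 w j < nth 0 w i].

Definition swrec (w : seq nat) : nat :=
  \sum_(i < size w | is_record w i) i.+1 * nth 0 w i.

(** * Formal power series in x *)

Local Open Scope ring_scope.

(* A series is identified with its sequence of coefficients. *)
Definition fps (A : Type) : Type := nat -> A.

Declare Scope fps_scope.
Delimit Scope fps_scope with fps.
Bind Scope fps_scope with fps.

Definition fps_const (c : rat) : fps rat := fun n => if n == 0%N then c else 0.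
Definition fps_X : fps rat := fun n => if n == 1%N then 1 else 0.
Definition fps_add (f g : fps rat) : fps rat := fun n => f n + g n.
Definition fps_sub (f g : fps rat) : fps rat := fun n => f n - g n.
Definition fps_scale (c : rat) (f : fps rat) : fps rat := fun n => c * f n.
Definition fps_mul (f g : fps rat) : fps rat :=
  fun n => \sum_(i < n.+1) f i * g (n - i)%N.
Definition fps_pow (f : fps rat) (k : nat) : fps rat :=
  iter k (fps_mul f) (fps_const 1).

(* exp f = \sum_(k >= 0) f^k / k!, meaningful when f has zero constant term;
   then f^k has no term of degree < k, so the sum defining the coefficient of
   x^n stops at k = n. *)
Definition fps_exp (f : fps rat) : fps rat :=
  fun n => \sum_(k < n.+1) (k`!)%:R^-1 * fps_pow f k n.

Notation "f + g" := (fps_add f g) : fps_scope.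
Notation "f - g" := (fps_sub f g) : fps_scope.
Notation "f * g" := (fps_mul f g) : fps_scope.
Notation "c *: f" := (fps_scale c%R f) : fps_scope.

(** * The generating functions *)

(* Coefficients live in Q[u][q]: the outer variable is q, the inner one u. *)
Definition var_q : {poly {poly rat}} := 'X.
Definition var_u : {poly {poly rat}} := 'X%:P.

(* \sum_(k >= 1) \sum_(n >= k) ... , collected by powers of x: for a given n
   the index k runs over 1 <= k <= n. *)
Definition Ptilde : fps {poly {poly rat}} := fun n =>
  \sum_(1 <= k < n.+1) \sum_(P in set_partitions_into n k)
    ((n`!)%:R^-1 : rat)%:P%:P * var_u ^+ k * var_q ^+ swrec (canonical_form P).

Definition fps_diff_q (F : fps {poly {poly rat}}) : fps {poly {poly rat}} :=
  fun n => (F n)^`().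

(* Horner evaluation: first q, then u. *)
Definition fps_eval_uq (F : fps {poly {poly rat}}) (u0 q0 : rat) : fps rat :=
  fun n => (F n).[q0%:P].[u0].

Definition total_swrec (n : nat) : nat :=
  (\sum_(P in set_partitions n) swrec (canonical_form P))%N.

Definition egf (a : nat -> nat) : fps rat := fun n => (a n)%:R / (n`!)%:R.

(* Main.v *)
From HB Require Import structures.
Require Import Defs.
From mathcomp Require Import all_boot all_order all_algebra.
From mathcomp Require Import boolp zify ring.

(* In a canonical sequential form the records are the first occurrences of the
   letters, so appending a letter to a word of length n with k blocks either
   repeats one of the k letters and leaves swrec unchanged, or creates the
   letter k + 1 and adds (n + 1)(k + 1).  With theta = u d/du, the exponential
   generating functions S(x, u) of partitions and F(x, u) of swrec therefore
   satisfy
     S_x = u S + theta S   and   F_x = u F + theta F + theta (u (S + x S_x)).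
   The first equation forces S_x = u e^x S, and writing F = S G turns the
   second into G_x - theta G = u + u^2 (e^x - 1) + 2 x u^2 e^x
   + x u^3 e^x (e^x - 1), whose solution vanishing at x = 0 is a cubic
   polynomial in u.  The theorem is the value of S G at u = 1. *)

Set Implicit Arguments.
Unset Strict Implicit.
Unset Printing Implicit Defensive.

Import GRing.Theory Num.Theory.

(** * Restricted growth words *)

(** For a restricted growth word this is also the number of blocks, since every letter from 1 up to
    the maximum occurs. *)
Definition letter_max (w : seq nat) : nat := \max_(x <- w) x.

(** These words turn out to be exactly the canonical sequential forms. The empty prefix has maximum
    0, which forces the first letter to be 1. *)
Definition restricted_growth (w : seq nat) : bool :=
  all (fun i => 0 < nth 0 w i <= (letter_max (take i w)).+1) (iota 0 (size w)).

(** Enumeration by the last letter, so that sums over words of length n + 1 unfold into sums over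
    words of length n. The last choice, j = [letter_max w], is the one that opens a new block. *)
Fixpoint growth_words (n : nat) : seq (seq nat) :=
  if n is m.+1 then
    [seq rcons w j.+1 | w <- growth_words m, j <- iota 0 (letter_max w).+1]
  else [:: [::]].

Lemma letter_max_rcons w x : letter_max (rcons w x) = maxn (letter_max w) x.
Proof. by rewrite /letter_max big_rcons. Qed.

Lemma leq_letter_max w x : x \in w -> x <= letter_max w.
Proof. by move=> xw; exact: (@leq_bigmax_seq _ _ xpredT id). Qed.

Lemma letter_max_ltn w m : (letter_max w < m.+1) = all (fun x => x < m.+1) w.
Proof.
elim/last_ind: w => [|w x IHw]; first by rewrite /letter_max big_nil.
by rewrite letter_max_rcons all_rcons gtn_max IHw andbC.
Qed.

Lemma restricted_growth_rcons w x :
  restricted_growth (rcons w x)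
  = restricted_growth w && (0 < x <= (letter_max w).+1).
Proof.
rewrite /restricted_growth size_rcons -[(size w).+1]addn1 iotaD all_cat.
rewrite add0n /= andbT.
rewrite nth_rcons ltnn eqxx -cats1 take_size_cat //; congr andb.
apply: eq_in_all => i; rewrite mem_iota add0n => /= lt_iw.
by rewrite nth_cat lt_iw takel_cat // ltnW.
Qed.

Lemma mem_growth_words n w :
  (w \in growth_words n) = (size w == n) && restricted_growth w.
Proof.
elim: n w => [|n IHn] w; first by rewrite inE; case: w.
apply/allpairsPdep/andP => [[v [j [vn jv ->]]]|[]].
  move: vn; rewrite IHn size_rcons restricted_growth_rcons eqSS => /andP[-> ->].
  by move: jv; rewrite mem_iota.
case/lastP: w => [//|w x]; rewrite size_rcons eqSS restricted_growth_rcons.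
move=> sw /and3P[gw x_gt0 x_le]; exists w, x.-1.
rewrite (prednK x_gt0); split=> //.
  by rewrite IHn sw.
by rewrite mem_iota add0n /= prednK.
Qed.

Lemma growth_words_uniq n : uniq (growth_words n).
Proof.
elim: n => // n IHn; apply: allpairs_uniq_dep => // [w _|].
  exact: iota_uniq.
move=> [v i] [w j] _ _ /= /rcons_inj [-> ->]; by [].
Qed.

(** The running maximum starts at 0 and rises by at most one per letter, so no value is skipped. *)
Lemma restricted_growth_mem w v :
  restricted_growth w -> 0 < v <= letter_max w -> v \in w.
Proof.
elim/last_ind: w => [|w x IHw]; first by rewrite /letter_max big_nil; case: v.
rewrite restricted_growth_rcons letter_max_rcons mem_rcons inE.
move=> /and3P[gw x_gt0 x_le] /andP[v_gt0 v_le].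
have [->//|neq_vx /=] := eqVneq v x; apply: IHw => //; rewrite v_gt0 /=.
by move: neq_vx v_le x_le; lia.
Qed.

Lemma restricted_growth_take w i :
  restricted_growth w -> restricted_growth (take i w).
Proof.
elim/last_ind: w => // w x IHw; rewrite restricted_growth_rcons => /andP[gw hx].
have [le_iw|lt_wi] := leqP i (size w).
  by rewrite -cats1 takel_cat // IHw.
by rewrite take_oversize ?size_rcons // restricted_growth_rcons gw hx.
Qed.

(** The prefix before the first v' has maximum at least v' - 1, hence at least v, so it already
    contains v. *)
Lemma restricted_growth_index w v v' : restricted_growth w ->
  0 < v < v' -> v' <= letter_max w -> index v w < index v' w.
Proof.
move=> gw /andP[v_gt0 lt_vv'] v'_le.
have v'w : v' \in w.
  by apply: restricted_growth_mem => //; rewrite (ltn_trans v_gt0 lt_vv').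
have lt_iw : index v' w < size w by rewrite index_mem.
have /allP/(_ (index v' w)) := gw.
rewrite mem_iota /= add0n lt_iw nth_index // => /(_ isT) /andP[_ le_v'].
have: v \in take (index v' w) w.
  apply: restricted_growth_mem; first exact: restricted_growth_take.
  by rewrite v_gt0 -ltnS (leq_trans lt_vv').
by rewrite in_take_leq // ltnW.
Qed.

(** Whether an entry is a record depends only on the prefix up to it, so the old records are kept.
    The new letter x + 1 is a record exactly when no earlier letter exceeds x; its position counted
    from 1 is [(size w).+1]. *)
Lemma swrec_rcons w x :
  swrec (rcons w x.+1)
  = swrec w + (if x < letter_max w then 0 else (size w).+1 * x.+1).
Proof.
rewrite /swrec size_rcons big_mkcond big_ord_recr /= [in RHS]big_mkcond /=.
congr (_ + _).
  apply: eq_bigr => i _; rewrite nth_rcons ltn_ord.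
  congr (if _ then _ else _); apply: eq_forallb => j.
  by rewrite !nth_rcons ltn_ord (ltn_trans (ltn_ord j)).
rewrite nth_rcons ltnn eqxx.
suff -> : is_record (rcons w x.+1) (size w) = ~~ (x < letter_max w).
  by case: (x < _).
rewrite -leqNgt -ltnS letter_max_ltn.
apply/forallP/(all_nthP 0) => [H i lt_iw|H j].
  by have := H (Ordinal lt_iw); rewrite !nth_rcons lt_iw ltnn eqxx.
by rewrite !nth_rcons ltn_ord ltnn eqxx H.
Qed.

(** * Canonical forms of set partitions *)

Section CanonicalForm.
Variable n : nat.
Implicit Types (B C : {set 'I_n}) (P : {set {set 'I_n}}) (i j : 'I_n).

Lemma block_min_le B i : i \in B -> block_min B <= i.
Proof.
rewrite /block_min; have: i \in index_enum 'I_n by rewrite mem_index_enum.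
elim: (index_enum _) => // j s IHs; rewrite inE big_cons => i_js iB.
case/predU1P: i_js iB => [<- ->|i_s iB]; first exact: geq_minl.
by case: ifP => _; rewrite ?geq_min IHs ?orbT.
Qed.

Lemma block_min_mem B i :
  i \in B -> exists2 j, j \in B & j = block_min B :> nat.
Proof.
move=> iB; have [j jB jmin] := arg_minnP (fun j : 'I_n => j : nat) iB.
exists j => //; apply/eqP; rewrite eqn_leq block_min_le // andbT.
rewrite /block_min; elim/big_ind: _ => //; first exact/ltnW.
by move=> x y lx ly; rewrite leq_min lx.
Qed.

Lemma size_canonical_form P : size (canonical_form P) = n.
Proof. by rewrite size_map size_enum_ord. Qed.

Lemma nth_canonical_form P i :
  nth 0 (canonical_form P) i = (index (pblock P i) (ordered_blocks P)).+1.
Proof. by rewrite (nth_map i) ?size_enum_ord // nth_ord_enum. Qed.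

Lemma mem_ordered_blocks P B : (B \in ordered_blocks P) = (B \in P).
Proof. by rewrite mem_sort mem_enum. Qed.

Lemma ordered_blocks_uniq P : uniq (ordered_blocks P).
Proof. by rewrite sort_uniq enum_uniq. Qed.

Lemma canonical_form_restricted_growth P :
  partition P [set: 'I_n] -> restricted_growth (canonical_form P).
Proof.
move=> partP; have /and3P[/eqP covP trivP set0P] := partP.
have memP i : pblock P i \in ordered_blocks P.
  by rewrite mem_ordered_blocks pblock_mem // covP inE.
apply/allP => k; rewrite mem_iota size_canonical_form /= => lt_kn.
pose i : 'I_n := Ordinal lt_kn.
have ->: k = i by [].
rewrite nth_canonical_form /= ltnS.
case def_m: (index _ _) => [//|m].
have lt_m : m.+1 < size (ordered_blocks P) by rewrite -def_m index_mem.
(* [C] is the block just before that of [i]. Its least element [j] carries the letter m + 1, and it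
   is at most [i] because blocks are sorted by minimum; it differs from [i] because the letters
   differ. *)
pose C := nth set0 (ordered_blocks P) m.
have CP : C \in P by rewrite -mem_ordered_blocks mem_nth // ltnW.
have [z zC] : exists z, z \in C.
  by apply/set0Pn; apply: contraNneq set0P => <-.
have [j jC jmin] := block_min_mem zC.
have pj : pblock P j = C by apply: def_pblock.
have wj : nth 0 (canonical_form P) j = m.+1.
  by rewrite nth_canonical_form pj index_uniq ?ordered_blocks_uniq // ltnW.
have le_ji : j <= i.
  have iP : i \in pblock P i by rewrite mem_pblock covP inE.
  rewrite jmin; apply: leq_trans (block_min_le iP).
  rewrite -[pblock P i](nth_index set0 (memP i)) def_m.
  apply: (@sorted_leq_nth _ (fun B C => block_min B <= block_min C)) => //.
  - by move=> ? ? ?; exact: leq_trans.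
  - by apply: sort_sorted => ? ?; exact: leq_total.
  - by rewrite inE ltnW.
have lt_ji : j < i.
  rewrite ltn_neqAle le_ji andbT; apply/eqP => eq_ji.
  by move: wj; rewrite eq_ji nth_canonical_form def_m => -[]; lia.
apply: leq_letter_max; rewrite -wj -(nth_take 0 lt_ji) mem_nth //.
by rewrite size_take size_canonical_form ltn_ord.
Qed.

(** Two positions lie in the same block if and only if they carry the same letter, so the word
    determines the equivalence relation and with it the partition. *)
Lemma canonical_form_inj :
  {in set_partitions n &, injective (@canonical_form n)}.
Proof.
move=> P Q; rewrite !inE => partP partQ eqPQ.
rewrite -(preim_partition_pblock partP) -(preim_partition_pblock partQ).
have eq_pblock R : partition R [set: 'I_n] -> forall i j,
    (pblock R i == pblock R j)
    = (nth 0 (canonical_form R) i == nth 0 (canonical_form R) j).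
  move=> /and3P[/eqP covR _ _] i j; rewrite !nth_canonical_form eqSS.
  have memR k : pblock R k \in ordered_blocks R.
    by rewrite mem_ordered_blocks pblock_mem // covR inE.
  apply/eqP/eqP => [->//|eq_ij]; exact: (index_inj set0) eq_ij.
apply: eq_imset => i; apply/setP => j.
by rewrite !inE !eq_pblock // eqPQ.
Qed.

(** The blocks are the fibres of the word. The minimum of the fibre of v is the first occurrence of
    v, and first occurrences increase with v, so sorting by minimum numbers each fibre by its own
    letter. *)
Lemma canonical_form_surj w : size w = n -> restricted_growth w ->
  exists2 P, P \in set_partitions n & canonical_form P = w.
Proof.
move=> size_w gw.
pose f i := nth 0 w i.
pose P := preim_partition f [set: 'I_n].
have partP : partition P [set: 'I_n] by apply: preim_partitionP.
have /and3P[/eqP covP trivP set0P] := partP.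
exists P; first by rewrite inE.
pose L v : {set 'I_n} := [set i | f i == v].
have f_gt0 i : 0 < f i <= letter_max w.
  have lt_iw : i < size w by rewrite size_w.
  have /allP/(_ i) := gw; rewrite mem_iota /= lt_iw => /(_ isT) /andP[-> _] /=.
  by apply: leq_letter_max; rewrite mem_nth.
have pblockP i : pblock P i = L (f i).
  apply/setP => j; rewrite pblock_equivalence_partition ?inE //.
  by split=> // /eqP->.
have LP v : 0 < v <= letter_max w ->
    exists2 i, i \in L v & i = index v w :> nat.
  move=> hv; have vw := restricted_growth_mem gw hv.
  have lt_in : index v w < n by rewrite -size_w index_mem.
  by exists (Ordinal lt_in); rewrite // inE /f /= nth_index.
have minL v : 0 < v <= letter_max w -> block_min (L v) = index v w.
  move=> hv; have [i iL def_i] := LP v hv.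
  have [j jL def_j] := block_min_mem iL.
  apply/eqP; rewrite eqn_leq -def_i block_min_le // -def_j def_i.
  move: jL; rewrite inE => /eqP <-.
  by rewrite /f index_nth // size_w.
have P_L B : (B \in P) = (B \in [seq L v | v <- iota 1 (letter_max w)]).
  apply/idP/mapP => [BP|[v]].
    have /set0Pn[i iB] : B != set0 by apply: contraNneq set0P => <-.
    exists (f i); first by rewrite mem_iota add1n ltnS f_gt0.
    by rewrite -pblockP (def_pblock trivP BP).
  rewrite mem_iota add1n ltnS => /LP[i iL _] ->.
  by move: iL; rewrite inE => /eqP <-; rewrite -pblockP pblock_mem ?covP.
have L_inj : {in iota 1 (letter_max w) &, injective (fun v => block_min (L v))}.
  move=> v v' /=; rewrite !mem_iota !add1n !ltnS => hv hv'; rewrite !minL //.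
  by apply: (index_inj 0); apply: restricted_growth_mem.
have ordP : ordered_blocks P = [seq L v | v <- iota 1 (letter_max w)].
  apply/esym.
  (* Both lists are sorted by block minimum and have the same elements. Antisymmetry holds on the
     fibres only, where distinct blocks have distinct minima. *)
  apply: (@sorted_eq_in _ (fun B C => block_min B <= block_min C)).
  - by move=> ? ? ? _ _ _; exact: leq_trans.
  - move=> _ _ /mapP[v hv ->] /mapP[v' hv' ->]; rewrite -eqn_leq => /eqP.
    by move/L_inj => ->.
  - rewrite sorted_map.
    apply: (@sub_in_sorted _ (mem (iota 1 (letter_max w))) ltn).
    + move=> v v'; rewrite !mem_iota !add1n !ltnS => hv hv' lt_vv' /=.
      rewrite !minL //; apply/ltnW/restricted_growth_index => //.
        by apply/andP; split=> //; case/andP: hv.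
      by case/andP: hv'.
    + exact/allP.
    + exact: iota_ltn_sorted.
  - by apply: sort_sorted => ? ?; exact: leq_total.
  - rewrite uniq_perm ?ordered_blocks_uniq //; last first.
      by move=> B; rewrite mem_ordered_blocks P_L.
    rewrite map_inj_in_uniq ?iota_uniq // => v v' hv hv' eqL.
    by apply: L_inj => //=; rewrite eqL.
apply: (@eq_from_nth _ 0); rewrite size_canonical_form // => k lt_kn.
rewrite -[k]/(val (Ordinal lt_kn)) nth_canonical_form pblockP ordP.
have := f_gt0 (Ordinal lt_kn); set v := f _ => hv.
have hv' : v \in iota 1 (letter_max w) by rewrite mem_iota add1n ltnS.
have -> : index (L v) [seq L v | v <- iota 1 (letter_max w)]
    = index v (iota 1 (letter_max w)).
  rewrite -{1}(nth_index 0 hv') -(nth_map 0 set0 L) ?index_mem // index_uniq //.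
    by rewrite size_map index_mem.
  rewrite map_inj_in_uniq ?iota_uniq // => x y hx hy eqL.
  by apply: L_inj => //=; rewrite eqL.
case/andP: hv => v_gt0 v_le.
have -> : index v (iota 1 (letter_max w)) = v.-1.
  have lt_v : v.-1 < letter_max w by rewrite prednK.
  rewrite -{1}(prednK v_gt0) -add1n -(nth_iota 0 1 lt_v).
  by rewrite index_uniq ?iota_uniq // size_iota.
by rewrite prednK.
Qed.

Lemma canonical_form_enum :
  perm_eq [seq canonical_form P | P <- enum (set_partitions n)]
    (growth_words n).
Proof.
apply: uniq_perm; rewrite ?growth_words_uniq //.
  rewrite map_inj_in_uniq ?enum_uniq // => P Q.
  by rewrite !mem_enum; apply: canonical_form_inj.
move=> w; rewrite mem_growth_words; apply/mapP/andP => [[P]|[/eqP sw gw]].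
  rewrite mem_enum inE => partP ->; rewrite size_canonical_form eqxx.
  by rewrite canonical_form_restricted_growth.
by have [P PP <-] := canonical_form_surj sw gw; exists P; rewrite ?mem_enum.
Qed.

End CanonicalForm.

(** * The ring of formal power series *)

Local Open Scope ring_scope.

(* A copy of [fps] to carry the ring structure: the scope bound to [fps] would
   capture [+] and [*]. *)
Definition series (A : Type) : Type := nat -> A.

Section SeriesRing.
Variable R : comNzRingType.
Implicit Types f g h : series R.

HB.instance Definition _ := gen_eqMixin (series R).
HB.instance Definition _ := gen_choiceMixin (series R).

Definition series_mul f g : series R :=
  fun n => \sum_(i < n.+1) f i * g (n - i)%N.
Definition series_const (c : R) : series R :=
  fun n => if n == 0%N then c else 0.

Let series_add f g : series R := fun n => f n + g n.

(** The coefficients of a product up to degree n involve only coefficients up to degree n, so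
    associativity, commutativity and the Leibniz rule can be inherited from polynomials. *)
Let truncation n f : {poly R} := \poly_(i < n.+1) f i.

Let truncation_coef n f i : (i <= n)%N -> (truncation n f)`_i = f i.
Proof. by move=> le_in; rewrite coef_poly ltnS le_in. Qed.

Let series_mul_coef n f g i : (i <= n)%N ->
  series_mul f g i = (truncation n f * truncation n g)`_i.
Proof.
move=> le_in; rewrite coefM; apply: eq_bigr => j _.
have le_ji : (j <= i)%N by rewrite -ltnS.
by rewrite !truncation_coef ?(leq_trans le_ji) ?(leq_trans (leq_subr _ _)).
Qed.

Let series_mulA : associative series_mul.
Proof.
move=> f g h; apply/funext => n.
have -> : series_mul f (series_mul g h) n
    = (truncation n f * (truncation n g * truncation n h))`_n.
  rewrite coefM; apply: eq_bigr => i _.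
  by rewrite truncation_coef -1?ltnS // (@series_mul_coef n) ?leq_subr.
rewrite mulrA coefM; apply: eq_bigr => i _.
by rewrite truncation_coef ?leq_subr // (@series_mul_coef n) -1?ltnS.
Qed.

Let series_mulC : commutative series_mul.
Proof.
by move=> f g; apply/funext => n; rewrite !(@series_mul_coef n) // mulrC.
Qed.

Let series_mul1 : left_id (series_const 1) series_mul.
Proof.
move=> f; apply/funext => n.
rewrite /series_mul big_ord_recl subn0 mul1r big1 ?addr0 // => i _.
by rewrite mul0r.
Qed.

Let series_mulDl : left_distributive series_mul series_add.
Proof.
move=> f g h; apply/funext => n; rewrite /series_add /series_mul -big_split /=.
by apply: eq_bigr => i _; rewrite mulrDl.
Qed.

Let series_addA : associative series_add.
Proof. by move=> f g h; apply/funext => n; rewrite /series_add addrA. Qed.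
Let series_addC : commutative series_add.
Proof. by move=> f g; apply/funext => n; rewrite /series_add addrC. Qed.
Let series_add0 :
  left_id (fun=> 0 : R) series_add.
Proof. by move=> f; apply/funext => n; rewrite /series_add add0r. Qed.
Let series_addN : left_inverse (fun=> 0 : R) (fun f n => - f n)
  series_add.
Proof. by move=> f; apply/funext => n; rewrite /series_add addNr. Qed.

HB.instance Definition _ :=
  GRing.isZmodule.Build (series R)
    series_addA series_addC series_add0 series_addN.

Let series_one_neq0 : series_const 1 != 0 :> series R.
Proof.
by apply/eqP => /(congr1 (fun f : series R => f 0%N)) /eqP; rewrite oner_eq0.
Qed.

HB.instance Definition _ := GRing.Zmodule_isComNzRing.Build (series R)
  series_mulA series_mulC series_mul1 series_mulDl series_one_neq0.

Lemma coefs0 n : (0 : series R) n = 0. Proof. by []. Qed.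
Lemma coefs1 n : (1 : series R) n = if n == 0%N then 1 else 0.
Proof. by []. Qed.
Lemma coefsD f g n : (f + g) n = f n + g n. Proof. by []. Qed.
Lemma coefsN f n : (- f) n = - f n. Proof. by []. Qed.
Lemma coefsM f g n : (f * g) n = \sum_(i < n.+1) f i * g (n - i)%N.
Proof. by []. Qed.
Lemma coefsMn f m n : (f *+ m) n = f n *+ m.
Proof. by elim: m => // m IHm; rewrite !mulrS coefsD IHm. Qed.

Lemma coefs_constM c f n : (series_const c * f) n = c * f n.
Proof.
rewrite coefsM big_ord_recl subn0 big1 ?addr0 // => i _.
by rewrite /series_const /= mul0r.
Qed.

Definition series_X : series R := fun n => if n == 1%N then 1 else 0.

Lemma coefs_XM f n : (series_X * f) n = if n is m.+1 then f m else 0.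
Proof.
rewrite coefsM; case: n => [|n]; first by rewrite big_ord1 /series_X mul0r.
rewrite big_ord_recl /series_X /= mul0r add0r big_ord_recl /= mul1r subSS subn0.
by rewrite big1 ?addr0 // => i _; rewrite /= mul0r.
Qed.

(** * Formal differentiation in x *)

Definition series_deriv f : series R := fun n => f n.+1 *+ n.+1.

Lemma series_derivD f g :
  series_deriv (f + g) = series_deriv f + series_deriv g.
Proof. by apply/funext => n; rewrite /series_deriv !coefsD mulrnDl. Qed.

Lemma series_derivN f : series_deriv (- f) = - series_deriv f.
Proof. by apply/funext => n; rewrite /series_deriv !coefsN mulNrn. Qed.

Lemma series_deriv_const c : series_deriv (series_const c) = 0.
Proof. by apply/funext => n; rewrite /series_deriv /series_const mul0rn. Qed.

Lemma series_deriv_X : series_deriv series_X = 1.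
Proof.
by apply/funext => -[|n]; rewrite /series_deriv /series_X ?mulr1n //= mul0rn.
Qed.

Lemma series_derivM f g :
  series_deriv (f * g) = series_deriv f * g + f * series_deriv g.
Proof.
apply/funext => n; rewrite coefsD !coefsM /series_deriv.
(* Coefficient n of a derivative reads coefficient n + 1, hence the truncation at n + 1. *)
rewrite [(f * g) _](@series_mul_coef n.+1) // -coef_deriv derivM coefD !coefM.
congr (_ + _); apply: eq_bigr => i _; rewrite coef_deriv !truncation_coef //.
- by rewrite (leq_trans (leq_subr _ _)).
- by rewrite ltnS leq_subr.
- by rewrite ltnW.
Qed.

End SeriesRing.
Arguments series_X {R}.

(** * Exponentials *)

Lemma series_derivX (R : comNzRingType) (f : series R) k :
  series_deriv (f ^+ k.+1) = f ^+ k * series_deriv f *+ k.+1.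
Proof.
elim: k => [|k IHk]; first by rewrite expr0 mul1r.
by rewrite exprS series_derivM IHk exprS; ring.
Qed.

Lemma coefsX_eq0 (R : comNzRingType) (f : series R) k n :
  f 0%N = 0 -> (n < k)%N -> (f ^+ k) n = 0.
Proof.
move=> f0; elim: k n => // k IHk n lt_nk.
rewrite exprS coefsM big1 // => -[[|i] lt_i] _ /=.
  by rewrite f0 mul0r.
rewrite IHk ?mulr0 //; case: n lt_nk lt_i => // n lt_nk _.
by rewrite subSS (leq_ltn_trans (leq_subr _ _)).
Qed.

Lemma fps_powE (f : series rat) k : fps_pow f k = f ^+ k.
Proof. by elim: k => // k IHk; rewrite exprS -IHk. Qed.

Lemma series_deriv_exp (f : series rat) : f 0%N = 0 ->
  series_deriv (fps_exp f) = series_deriv f * (fps_exp f : series rat).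
Proof.
move=> f0; apply/funext => n; rewrite coefsM.
(* Since f^k has no term of degree below k, the sum over k may be extended to k <= n for every i.
   The bounds then no longer depend on i, and the two sums can be exchanged. *)
have expE i : (i <= n)%N ->
    fps_exp f (n - i)%N = \sum_(k < n.+1) (k`!)%:R^-1 * (f ^+ k) (n - i)%N.
  move=> _; rewrite /fps_exp; under eq_bigr do rewrite fps_powE.
  rewrite -!(big_mkord xpredT (fun k => (k`!)%:R^-1 * (f ^+ k) (n - i)%N)).
  rewrite (big_cat_nat (n := (n - i).+1) (p := n.+1)) //= ?ltnS ?leq_subr //.
  rewrite [X in _ = _ + X]big_nat_cond [X in _ = _ + X]big1 ?addr0 // => k.
  by rewrite andbT => /andP[lt_k _]; rewrite coefsX_eq0 ?mulr0.
under eq_bigr => i _ do rewrite expE -1?ltnS // mulr_sumr.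
rewrite exchange_big /= /series_deriv /fps_exp.
rewrite big_ord_recl fps_powE expr0 coefs1 mulr0 add0r -mulr_natr mulr_suml.
apply: eq_bigr => k _; rewrite fps_powE lift0 -mulrA mulr_natr.
rewrite -[(f ^+ k.+1) _ *+ _]/(series_deriv (f ^+ k.+1) n).
rewrite series_derivX coefsMn.
have fE : (k.+1`!)%:R^-1 * k.+1%:R = (k`!)%:R^-1 :> rat.
  by rewrite factS natrM invfM mulrAC mulVf ?mul1r // pnatr_eq0.
rewrite -[X in _ * X]mulr_natl mulrA fE [f ^+ k * _]mulrC coefsM mulr_sumr.
by apply: eq_bigr => i _; rewrite mulrCA.
Qed.

(** The coefficient of x^i in the equation expresses (i + 1) y_(i+1) through y_0, ..., y_i. *)
Lemma series_linear_ode_unique (a y z : series rat) :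
  series_deriv y = a * y -> series_deriv z = a * z -> y 0%N = z 0%N -> y = z.
Proof.
move=> dy dz yz0; apply/funext.
suff H n i : (i <= n)%N -> y i = z i by move=> n; exact: (H n).
elim: n i => [|n IHn] [|i] // le_in.
have nz : (i.+1%:R : rat) != 0 by rewrite pnatr_eq0.
apply: (mulIf nz); rewrite !mulr_natr.
rewrite -[LHS]/(series_deriv y i) -[RHS]/(series_deriv z i) dy dz !coefsM.
apply: eq_bigr => j _; rewrite IHn // (leq_trans (leq_subr _ _)) //.
Qed.

Lemma fps_exp_coef0 f : fps_exp f 0%N = 1.
Proof. by rewrite /fps_exp big_ord1 /= fact0 invr1 mul1r. Qed.

(** * The bivariate generating functions *)

(** The operator u d/du: it multiplies u^k by k, the number of ways to repeat one of k letters. *)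
Definition euler_op (p : {poly rat}) : {poly rat} := 'X * p^`().

Lemma euler_opD p q : euler_op (p + q) = euler_op p + euler_op q.
Proof. by rewrite /euler_op derivD mulrDr. Qed.
Lemma euler_opN p : euler_op (- p) = - euler_op p.
Proof. by rewrite /euler_op derivN mulrN. Qed.
Lemma euler_opM p q : euler_op (p * q) = euler_op p * q + p * euler_op q.
Proof. by rewrite /euler_op derivM; ring. Qed.
Lemma euler_opXn n : euler_op 'X^n = 'X^n *+ n.
Proof.
by rewrite /euler_op derivXn mulrnAr; case: n => // n; rewrite -exprS.
Qed.
Lemma euler_opMn p n : euler_op (p *+ n) = euler_op p *+ n.
Proof. by rewrite /euler_op derivMn mulrnAr. Qed.
Lemma euler_opZ c p : euler_op (c *: p) = c *: euler_op p.
Proof. by rewrite /euler_op derivZ scalerAr. Qed.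
Lemma euler_op0 : euler_op 0 = 0.
Proof. by rewrite /euler_op deriv0 mulr0. Qed.
Lemma euler_op_sum (I : Type) (r : seq I) (F : I -> {poly rat}) :
  euler_op (\sum_(i <- r) F i) = \sum_(i <- r) euler_op (F i).
Proof. exact: (big_morph _ euler_opD euler_op0). Qed.

(** The Touchard polynomial, whose coefficient of u^k is the Stirling number of the second kind S(n,
    k). *)
Definition block_poly (n : nat) : {poly rat} :=
  \sum_(w <- growth_words n) 'X^(letter_max w).

Definition swrec_poly (n : nat) : {poly rat} :=
  \sum_(w <- growth_words n) 'X^(letter_max w) *+ swrec w.

Lemma big_growth_wordsS (F : seq nat -> {poly rat}) n :
  \sum_(w <- growth_words n.+1) F w
  = \sum_(w <- growth_words n)
      (\sum_(j < letter_max w) F (rcons w j.+1)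
       + F (rcons w (letter_max w).+1)).
Proof.
rewrite [LHS]big_allpairs_dep; apply: eq_bigr => w _.
by rewrite -[iota _ _]/(index_iota 0 (letter_max w).+1) big_mkord big_ord_recr.
Qed.

Lemma block_polyS n :
  block_poly n.+1 = 'X * block_poly n + euler_op (block_poly n).
Proof.
rewrite /block_poly big_growth_wordsS mulr_sumr euler_op_sum -big_split /=.
apply: eq_bigr => w _; rewrite euler_opXn [LHS]addrC; congr (_ + _).
  by rewrite letter_max_rcons (maxn_idPr (leqnSn _)) exprS.
under eq_bigr => j _ do rewrite letter_max_rcons (maxn_idPl (ltn_ord j)).
by rewrite sumr_const card_ord.
Qed.

Lemma size_growth_words n w : w \in growth_words n -> size w = n.
Proof. by rewrite mem_growth_words => /andP[/eqP]. Qed.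

(** The first two terms arise as for [block_poly]. A new letter adds (n + 1)(k + 1) to the weight of
    u^(k+1), which is n + 1 times the Euler operator applied to u u^k. *)
Lemma swrec_polyS n : swrec_poly n.+1
  = 'X * swrec_poly n + euler_op (swrec_poly n)
    + euler_op ('X * block_poly n) *+ n.+1.
Proof.
rewrite /swrec_poly /block_poly big_growth_wordsS !mulr_sumr !euler_op_sum.
rewrite -sumrMnl -!big_split /= big_seq [RHS]big_seq.
apply: eq_bigr => w /size_growth_words size_w.
rewrite -exprS !euler_opMn !euler_opXn [LHS]addrC.
rewrite letter_max_rcons (maxn_idPr (leqnSn _)) swrec_rcons ltnn size_w.
have -> : \sum_(j < letter_max w)
    'X^(letter_max (rcons w j.+1)) *+ swrec (rcons w j.+1)
    = 'X^(letter_max w) *+ letter_max w *+ swrec w :> {poly rat}.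
  under eq_bigr => j _ do
    rewrite letter_max_rcons (maxn_idPl (ltn_ord j)) swrec_rcons ltn_ord addn0.
  by rewrite sumr_const card_ord mulrnAC.
rewrite mulrnDr mulrnAr -exprS [(n.+1 * _)%N]mulnC mulrnA; ring.
Qed.

(** * Differential equations in x and u *)

Section SwrecSeries.
Local Notation bseries := (series {poly rat}).
Implicit Types f g : bseries.

Definition theta f : bseries := fun n => euler_op (f n).

Lemma thetaD f g : theta (f + g) = theta f + theta g.
Proof. by apply/funext => n; rewrite /theta !coefsD euler_opD. Qed.
Lemma thetaN f : theta (- f) = - theta f.
Proof. by apply/funext => n; rewrite /theta !coefsN euler_opN. Qed.
Lemma thetaM f g : theta (f * g) = theta f * g + f * theta g.
Proof.
apply/funext => n; rewrite /theta coefsD !coefsM euler_op_sum -big_split /=.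
by apply: eq_bigr => i _; rewrite euler_opM.
Qed.

(** The equation reads (n + 1) f_(n+1) = u f_n + theta f_n, so a zero coefficient is followed by
    another. *)
Lemma series_pde_unique f : f 0%N = 0 ->
  series_deriv f = series_const 'X * f + theta f -> f = 0.
Proof.
move=> f0 df; apply/funext => n; rewrite coefs0; elim: n => // n IHn.
have := congr1 (fun g : bseries => g n) df.
rewrite coefsD coefs_constM /theta IHn mulr0 add0r /euler_op deriv0 mulr0.
rewrite /series_deriv => /eqP; rewrite -mulr_natl -polyC_natr mul_polyC.
by rewrite scaler_eq0 pnatr_eq0 => /eqP.
Qed.

Definition block_series : bseries := fun n => (n`!%:R^-1) *: block_poly n.
Definition swrec_series : bseries := fun n => (n`!%:R^-1) *: swrec_poly n.
Definition exp_series : bseries := fun n => (n`!%:R^-1)%:P.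
Local Notation u := (series_const 'X : bseries).
Local Notation E := exp_series.
Local Notation S := block_series.

Lemma factS_inv n : n.+1%:R * (n.+1`!)%:R^-1 = (n`!)%:R^-1 :> rat.
Proof.
by rewrite factS natrM invfM mulrA mulfV ?mul1r // pnatr_eq0.
Qed.

Lemma series_deriv_scale (a : nat -> {poly rat}) n :
  series_deriv (fun n => (n`!%:R^-1) *: a n : {poly rat}) n
  = (n`!%:R^-1) *: a n.+1.
Proof. by rewrite /series_deriv scalerMnl -[in RHS]factS_inv mulr_natl. Qed.

Lemma exp_series_deriv : series_deriv E = E.
Proof.
apply/funext => n.
by rewrite /series_deriv /E -polyCMn -(factS_inv n) mulr_natl.
Qed.

Lemma theta_const c : theta (series_const c) = series_const (euler_op c).
Proof.
apply/funext => -[|n] //; rewrite /theta /series_const /=.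
by rewrite /euler_op deriv0 mulr0.
Qed.

Lemma theta_u : theta u = u.
Proof. by rewrite theta_const /euler_op derivX mulr1. Qed.
Lemma theta_exp : theta E = 0.
Proof. by apply/funext => n; rewrite /theta /euler_op derivC mulr0. Qed.
Lemma theta_X : theta series_X = 0.
Proof.
apply/funext => -[|[|n]];
  rewrite /theta /series_X /= /euler_op ?deriv0 ?mulr0 //.
by rewrite -polyC1 derivC mulr0.
Qed.
Lemma theta_1 : theta 1 = 0.
Proof.
by rewrite theta_const -polyC1 /euler_op derivC mulr0; apply/funext => -[].
Qed.
Lemma theta_natr n : theta n%:R = 0.
Proof.
elim: n => [|n IHn]; last by rewrite mulrS thetaD IHn theta_1 addr0.
by apply/funext => n; rewrite /theta /euler_op deriv0 mulr0.
Qed.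
Lemma deriv_natr n : series_deriv n%:R = 0 :> bseries.
Proof.
elim: n => [|n IHn]; last first.
  by rewrite mulrS series_derivD IHn series_deriv_const addr0.
by apply/funext => n; rewrite /series_deriv coefs0 mul0rn.
Qed.

Lemma block_series_deriv : series_deriv S = u * S + theta S.
Proof.
apply/funext => n; rewrite series_deriv_scale block_polyS coefsD coefs_constM.
by rewrite /S /theta euler_opZ scalerDr scalerAr.
Qed.

Lemma block_series0 : S 0%N = 1.
Proof.
by rewrite /S /block_poly /= big_seq1 /letter_max big_nil fact0 invr1 scale1r.
Qed.

(** Because theta commutes with d/dx, the difference S_x - u e^x S solves the same homogeneous
    equation as S. It vanishes at x = 0, where S = 1 and S_x = u. *)
Lemma block_series_ode : series_deriv S = u * E * S.
Proof.
apply/eqP; rewrite -subr_eq0; apply/eqP/series_pde_unique.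
  rewrite coefsD coefsN -mulrA coefs_constM coefsM big_ord1 subnn block_series0.
  rewrite block_series_deriv coefsD coefs_constM /theta block_series0.
  rewrite /E fact0 invr1.
  by rewrite /euler_op -polyC1 derivC mulr0 !mulr1 addr0 subrr.
rewrite series_derivD series_derivN !series_derivM series_deriv_const.
rewrite exp_series_deriv {1}block_series_deriv series_derivD series_derivM.
rewrite series_deriv_const thetaD thetaN !thetaM theta_u theta_exp.
have -> : series_deriv (theta S) = theta (series_deriv S).
  by apply/funext => n; rewrite /series_deriv /theta euler_opMn.
by rewrite block_series_deriv; ring.
Qed.

(** The factor n + 1 in the recurrence turns S into S + x S_x. *)
Lemma swrec_series_deriv : series_deriv swrec_series
  = u * swrec_series + theta swrec_series
    + theta (u * (S + series_X * series_deriv S)).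
Proof.
apply/funext => n; rewrite series_deriv_scale swrec_polyS !coefsD coefs_constM.
rewrite {2}/theta coefs_constM coefsD coefs_XM /swrec_series /theta euler_opZ.
rewrite !scalerDr -scalerAr; congr (_ + _).
have -> : S n + (if n is m.+1 then series_deriv S m else 0) = S n *+ n.+1.
  by case: n => [|n]; rewrite ?addr0 // mulrS.
by rewrite /S mulrnAr euler_opMn -scalerAr euler_opZ scalerMnr.
Qed.

(* 4 G, the factor clearing the denominators so that [ring] applies. *)
Definition cofactor4 : bseries :=
  4 * u * (E - 1) + u ^+ 2 * (10 * E ^+ 2 - (12 + 8 * series_X) * E + 2)
  + u ^+ 3 * (3 * E ^+ 3 - 4 * (1 + series_X) * E ^+ 2
              + (1 + 2 * series_X) * E).

(** Both sides vanish at x = 0, and their difference solves the homogeneous equation. Once S_x and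
    theta S are written as multiples of S, what remains is a polynomial identity. *)
Lemma swrec_seriesE : 4 * swrec_series = S * cofactor4.
Proof.
apply/eqP; rewrite -subr_eq0; apply/eqP/series_pde_unique.
  have coefM0 (f g : bseries) : (f * g) 0%N = f 0%N * g 0%N.
    by rewrite coefsM big_ord1.
  have swrec0 : swrec_series 0%N = 0.
    rewrite /swrec_series /swrec_poly big_seq1 /swrec big_ord0.
    by rewrite mulr0n scaler0.
  have E0 : E 0%N = 1 by rewrite /E fact0 invr1.
  rewrite /cofactor4 !expr2 !exprS !(coefsD, coefsN, coefM0, coefsMn) swrec0 E0.
  by rewrite /series_X /=; ring.
(* Obtained by comparing the two expressions u S + theta S and u e^x S for S_x. *)
have thS : theta S = u * (E - 1) * S.
  have := block_series_deriv; rewrite block_series_ode => eS.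
  by apply: (addrI (u * S)); rewrite -eS; ring.
rewrite series_derivD series_derivN series_derivM deriv_natr swrec_series_deriv.
rewrite /cofactor4 !expr2 !exprS.
rewrite !(series_derivM, series_derivD, series_derivN, deriv_natr,
  series_deriv_const, exp_series_deriv, series_deriv_X, block_series_ode).
rewrite !(thetaM, thetaD, thetaN, theta_natr, theta_1, theta_u, theta_exp,
  theta_X, thS).
ring.
Qed.

End SwrecSeries.

(** * Evaluation at u = 1 *)

Lemma series_const_natr (R : comNzRingType) n :
  series_const n%:R = n%:R :> series R.
Proof.
apply/funext => k; rewrite coefsMn coefs1 /series_const.
by case: eqP => // _; rewrite mul0rn.
Qed.

(** Serves to replace 4 times a fractional constant by a numeral, so that [ring] meets no
    inverses. *)
Lemma series_natrM_const (R : comNzRingType) n (c d : R) :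
  n%:R * c = d -> n%:R * series_const c = series_const d.
Proof.
move=> <-; apply/funext => k.
rewrite -series_const_natr coefs_constM /series_const.
by case: eqP => // _; rewrite mulr0.
Qed.

Definition series_eval1 (f : series {poly rat}) : series rat :=
  fun n => (f n).[1].

Lemma series_eval1D f g :
  series_eval1 (f + g) = series_eval1 f + series_eval1 g.
Proof. by apply/funext => n; rewrite /series_eval1 coefsD hornerD. Qed.
Lemma series_eval1N f : series_eval1 (- f) = - series_eval1 f.
Proof. by apply/funext => n; rewrite /series_eval1 coefsN hornerN. Qed.
Lemma series_eval1M f g :
  series_eval1 (f * g) = series_eval1 f * series_eval1 g.
Proof.
apply/funext => n; rewrite /series_eval1 !coefsM horner_sum.
by apply: eq_bigr => i _; rewrite hornerM.
Qed.
Lemma series_eval1_const c : series_eval1 (series_const c) = series_const c.[1].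
Proof.
by apply/funext => -[|n] //; rewrite /series_eval1 /series_const /= horner0.
Qed.
Lemma series_eval1_natr n : series_eval1 n%:R = n%:R.
Proof.
rewrite -series_const_natr series_eval1_const -polyC_natr hornerC.
by rewrite series_const_natr.
Qed.
Lemma series_eval1_X : series_eval1 series_X = series_X.
Proof.
by apply/funext => -[|[|n]];
  rewrite /series_eval1 /series_X /= ?horner0 // hornerC.
Qed.
Lemma series_eval1_deriv f :
  series_eval1 (series_deriv f) = series_deriv (series_eval1 f).
Proof. by apply/funext => n; rewrite /series_eval1 /series_deriv hornerMn. Qed.

Lemma series_deriv_expX c :
  series_deriv (fps_exp (fps_scale c fps_X))
  = series_const c * (fps_exp (fps_scale c fps_X) : series rat).
Proof.
rewrite series_deriv_exp; last by rewrite /fps_scale mulr0.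
congr (_ * _); apply/funext => n.
rewrite /series_deriv /fps_scale /fps_X /series_const eqSS.
by case: eqP => [->|_]; rewrite ?mulr1 // mulr0 mul0rn.
Qed.

Lemma fps_scale1 f : fps_scale 1 f = f.
Proof. by apply/funext => n; rewrite /fps_scale mul1r. Qed.

Local Notation Ex := (fps_exp fps_X : series rat).

Lemma series_deriv_Ex : series_deriv Ex = Ex.
Proof. by rewrite -(fps_scale1 fps_X) series_deriv_expX mul1r. Qed.

(** Both sides solve y' = n y with y(0) = 1. *)
Lemma fps_exp_natX n : fps_exp (fps_scale n%:R fps_X) = Ex ^+ n.
Proof.
apply: (@series_linear_ode_unique n%:R).
- by rewrite -series_const_natr series_deriv_expX.
- case: n => [|n]; first by rewrite expr0 mul0r series_deriv_const.
  by rewrite series_derivX series_deriv_Ex -exprSr mulr_natl.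
rewrite fps_exp_coef0; elim: n => [|n IHn]; first by rewrite expr0.
by rewrite exprS coefsM big_ord1 -IHn fps_exp_coef0 mulr1.
Qed.

Lemma series_eval1_exp : series_eval1 exp_series = Ex.
Proof.
apply: (@series_linear_ode_unique 1); rewrite ?mul1r ?series_deriv_Ex //.
  by rewrite -series_eval1_deriv exp_series_deriv.
by rewrite fps_exp_coef0 /series_eval1 /exp_series hornerC fact0 invr1.
Qed.

(** At u = 1 the equation for S becomes y' = e^x y with y(0) = 1, which e^(e^x - 1) also solves. *)
Lemma series_eval1_block :
  series_eval1 block_series = fps_exp (fps_sub (fps_exp fps_X) (fps_const 1)).
Proof.
apply: (@series_linear_ode_unique Ex).
- rewrite -series_eval1_deriv block_series_ode !series_eval1M series_eval1_exp.
  by rewrite series_eval1_const hornerX (mul1r Ex).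
- rewrite series_deriv_exp; last by rewrite /fps_sub fps_exp_coef0 subrr.
  congr (_ * _); rewrite -[fps_sub _ _]/(Ex - series_const 1).
  rewrite series_derivD series_derivN series_deriv_const subr0.
  exact: series_deriv_Ex.
by rewrite fps_exp_coef0 /series_eval1 block_series0 hornerC.
Qed.

(** * From sums over partitions to the evaluated series *)

Lemma egf_total_swrec : egf total_swrec = series_eval1 swrec_series.
Proof.
apply/funext => n; rewrite /egf /total_swrec /series_eval1 /swrec_series.
rewrite hornerZ mulrC; congr (_ * _); rewrite /swrec_poly horner_sum.
under [RHS]eq_bigr do rewrite hornerMn hornerXn expr1n.
rewrite -(perm_big _ (canonical_form_enum n)) /= big_map big_enum /=.
by rewrite natr_sum.
Qed.

(** Differentiating in q brings down [swrec], so at u = q = 1 each partition contributes its [swrec]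
    over n!. The sum over k collapses because a partition has a single number of blocks. *)
Lemma fps_eval_diff_Ptilde :
  fps_eval_uq (fps_diff_q Ptilde) 1 1 = egf total_swrec.
Proof.
apply/funext => n; rewrite /fps_eval_uq /fps_diff_q /Ptilde /egf /total_swrec.
rewrite natr_sum mulr_suml.
have termE k (P : {set {set 'I_n}}) :
    ((((n`!)%:R^-1 : rat)%:P%:P * var_u ^+ k
      * var_q ^+ swrec (canonical_form P))^`()).[1%:P].[1]
    = (swrec (canonical_form P))%:R / (n`!)%:R.
  rewrite /var_u /var_q -rmorphXn -polyCM mul_polyC derivZ derivXn.
  rewrite hornerZ hornerMn hornerXn expr1n hornerM hornerMn hornerC.
  by rewrite hornerM hornerC hornerXn expr1n mulr1 mulr_natr mulr_natl.
rewrite raddf_sum !horner_sum.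
under eq_bigr => k _.
  rewrite raddf_sum !horner_sum; under eq_bigr do rewrite termE; over.
rewrite (exchange_big_dep (fun P => P \in set_partitions n)) /=; last first.
  by move=> k P _; rewrite !inE => /andP[].
(* For n = 0 the range of k is empty and misses the empty partition; this is harmless, since its
   word is empty and has [swrec] 0. *)
case: n termE => [|n] _.
  rewrite big1 ?big1 // => P _; last by rewrite big_geq.
  rewrite /swrec big1 ?mul0r // => -[i lt_i].
  by exfalso; rewrite size_canonical_form in lt_i.
apply: eq_bigr => P; rewrite inE => partP.
(* The next two facts place the number of blocks within the range 1 <= k <= n + 1: the ground set is
   nonempty, and the blocks are an image of its points. *)
have P_gt0 : (0 < #|P|)%N.
  rewrite card_gt0; apply/eqP => P0; have /and3P[/eqP + _ _] := partP.
  by rewrite P0 /cover big_set0 => /setP/(_ ord0); rewrite !inE.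
have P_le : (#|P| <= n.+1)%N.
  rewrite -(preim_partition_pblock partP) (leq_trans (leq_imset_card _ _)) //.
  by rewrite cardsT card_ord.
rewrite (eq_bigl (fun k => k == #|P|)) => [|k].
  2: by rewrite !inE partP eq_sym.
rewrite -big_filter filter_pred1_uniq ?iota_uniq ?big_seq1 //.
by rewrite mem_index_iota P_gt0 ltnS.
Qed.

Theorem theorem2 :
  let rhs : fps rat :=
    (fps_exp (fps_exp fps_X - fps_const 1)
     * ((3 / 4) *: fps_exp (3 *: fps_X) + (3 / 2) *: fps_exp (2 *: fps_X)
        - (7 / 4) *: fps_exp fps_X - fps_X * fps_exp (2 *: fps_X)
        - (3 / 2) *: (fps_X * fps_exp fps_X) - fps_const (1 / 2)))%fps in
  (fps_eval_uq (fps_diff_q Ptilde) 1 1 =1 rhs) /\ (egf total_swrec =1 rhs).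
Proof.
move=> rhs; rewrite fps_eval_diff_Ptilde.
suff -> : egf total_swrec = rhs by [].
have scaleE c (f : series rat) : fps_scale c f = series_const c * f.
  by apply/funext => n; rewrite coefs_constM.
have rhsE : rhs = series_eval1 block_series *
    (series_const (3 / 4) * Ex ^+ 3 + series_const (3 / 2) * Ex ^+ 2
     - series_const (7 / 4) * Ex - series_X * Ex ^+ 2
     - series_const (3 / 2) * (series_X * Ex) - series_const (1 / 2)).
  by rewrite -!fps_exp_natX -!scaleE series_eval1_block.
(* All denominators divide 4, so the identity is proved for 4 times both sides and the 4 is
   cancelled coefficientwise at the end. *)
have rhs4 : 4 * (rhs : series rat) = series_eval1 (4 * swrec_series).
  rewrite swrec_seriesE series_eval1M rhsE /cofactor4 !exprS !expr0.
  have a34 : 4 * series_const (3 / 4) = 3 :> series rat.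
    by rewrite (@series_natrM_const _ 4 _ 3%:R) ?series_const_natr.
  have a32 : 4 * series_const (3 / 2) = 6 :> series rat.
    by rewrite (@series_natrM_const _ 4 _ 6%:R) ?series_const_natr.
  have a74 : 4 * series_const (7 / 4) = 7 :> series rat.
    by rewrite (@series_natrM_const _ 4 _ 7%:R) ?series_const_natr.
  have a12 : 4 * series_const (1 / 2) = 2 :> series rat.
    by rewrite (@series_natrM_const _ 4 _ 2%:R) ?series_const_natr.
  rewrite !(series_eval1D, series_eval1N, series_eval1M, series_eval1_natr).
  rewrite series_eval1_const hornerX series_eval1_X series_eval1_exp.
  rewrite (series_eval1_natr 1) (series_const_natr _ 1).
  rewrite mulrCA !mulrDr !mulrN [4 * (_ (3 / 4) * _)]mulrA a34.
  rewrite [4 * (_ (7 / 4) * _)]mulrA a74.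
  rewrite !(mulrA 4 (series_const (3 / 2))) a32 a12.
  ring.
apply/funext => n; have := congr1 (fun f : series rat => f n) rhs4.
rewrite series_eval1M series_eval1_natr -!series_const_natr !coefs_constM.
by rewrite egf_total_swrec => /mulfI->.
Qed.
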